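(* Let $I_1,\ldots,I_r$ be monomial ideals of $R=\Bbbk[x_1,\ldots,x_n]$, and let $F_1,\ldots,F_r$ be (multigraded, free) DG algebra resolutions of $R/I_1,\ldots,R/I_r$, where $F_i$ has free basis $a_{i,1},\ldots,a_{i,n_i}$. Let $f,f'\in F_i$ be bigraded elements and consider the product $$ff'=\sum_{j_i=1}^{n_i}\alpha_{i,j_i,f,f'}\frac{m_fm_{f'}}{m_{a_{i,j_i}}}a_{i,j_i},\qquad \alpha_{i,j_i,f,f'}\in\Bbbk .$$ Let $f_1,f_1'\in F_1,\ldots,f_r,f_r'\in F_r$ be bigraded elements. The following product defines a DG algebra structure on the generalized Taylor resolution $F_1*\cdots*F_r$: $$(f_1*\cdots*f_r)(f_1'*\cdots*f_r')=(-1)^{\sum_{i=1}^r|f_i'|\sum_{j=i+1}^r|f_j|}\sum_{\substack{i=1,\ldots,r\\ j_i=1,\ldots,n_i}}\alpha_{1,j_1,f_1,f_1'}\cdots\alpha_{r,j_r,f_r,f_r'}\frac{[m_{f_1},\ldots,m_{f_r}]\,[m_{f_1'},\ldots,m_{f_r'}]}{[m_{a_{1,j_1}},\ldots,m_{a_{r,j_r}}]}\,a_{1,j_1}*\cdots*a_{r,j_r},$$ where the sum runs over all tuples $(j_1,\ldots,j_r)$ with $1\le j_i\le n_i$ for $i=1,\ldots,r$.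
   Context: Conventions. $\Bbbk$ is a field and $R=\Bbbk[x_1,\ldots,x_n]$ is $\mathbb{Z}^n$-graded, with $x_i$ of (multi)degree the $i$-th standard basis vector. Every complex over $R$ is bigraded: $|x|$ is the homological degree of $x$, and the internal (multi)degree of $x$ is denoted by the unique monomial $m_x$ with the same $\mathbb{Z}^n$-degree. Bigraded elements are elements homogeneous for both gradings. Brackets $[\ldots]$ denote the least common multiple. DG algebra. A DG algebra over $R$ is a complex $A$ of finitely generated free $R$-modules with differential $\partial$ and a unitary, associative multiplication that respects both the homological and the internal grading and such that, for homogeneous $a,b\in A$: $\partial(ab)=\partial(a)b+(-1)^{|a|}a\partial(b)$; $ab=(-1)^{|a||b|}ba$; and $a^2=0$ if $a$ has odd homological degree. Generalized Taylor resolution. Let $F_i$ be a multigraded free resolution of $R/I_i$ with free basis $a_{i,j}$, $j=1,\ldots,n_i$. For a multigraded element $f_i\in F_i$ of multidegree $m_{f_i}$, write $$\partial^{F_i}(f_i)=\sum_{j=1}^{n_i}\alpha_{i,j}\frac{m_{f_i}}{m_{a_{i,j}}}a_{i,j},\qquad \alpha_{i,j}\in\Bbbk .$$ The generalized Taylor resolution $F_1*\cdots*F_r$ is defined as follows. As bigraded $R$-modules, $F_1*\cdots*F_r=F_1\otimes_R\cdots\otimes_R F_r$, and a simple tensor $f_1\otimes\cdots\otimes f_r$ is denoted $f_1*\cdots*f_r$ for $f_i\in F_i$. The multidegree of $f_1*\cdots*f_r$ is defined to be $[m_{f_1},\ldots,m_{f_r}]$. The differential, on bigraded elements, is $$\partial(f_1*\cdots*f_r)=\sum_{i=1}^r(-1)^{|f_1|+\cdots+|f_{i-1}|}\sum_{j=1}^{n_i}\alpha_{i,j}\frac{[m_{f_1},\ldots,m_{f_r}]}{[m_{f_1},\ldots,m_{f_{i-1}},m_{a_{i,j}},m_{f_{i+1}},\ldots,m_{f_r}]}\,f_1*\cdots*f_{i-1}*a_{i,j}*f_{i+1}*\cdots*f_r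 .$$ Herzog proved that $F_1*\cdots*F_r$ is a multigraded free resolution of $R/(I_1+\cdots+I_r)$. *)

(* Defs.v *)
From mathcomp Require Import all_boot all_order all_algebra.
From mathcomp Require Import mpoly.

Set Implicit Arguments.
Unset Strict Implicit.
Unset Printing Implicit Defensive.

Import GRing.Theory.
Local Open Scope ring_scope.

(* An ideal is given by its membership predicate; a monomial ideal is the ideal
   generated by a set G of monomials. *)
Definition monomial_ideal (k : fieldType) (n : nat) (I : {mpoly k[n]} -> Prop) :=
  exists G : 'X_{1..n} -> Prop, forall p, I p <->
    exists s : seq ({mpoly k[n]} * 'X_{1..n}),
      (forall t, t \in s -> G t.2) /\ p = \sum_(t <- s) t.1 * 'X_[t.2].

(* A finite set of basis elements, with their homological degrees and their
   multidegrees (identified with monomials). *)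
Record mbasis (n : nat) := MBasis {
  idx :> finType;
  homdeg : idx -> nat;
  multideg : idx -> 'X_{1..n}
}.
Arguments homdeg {n B} : rename.
Arguments multideg {n B} : rename.

Section FreeModules.
Variables (k : fieldType) (n : nat).
Local Notation R := {mpoly k[n]}.

(* The bigraded free R-module on the basis B, in coordinates. *)
Definition free_mod (B : mbasis n) := {ffun B -> R^o}.

Definition ebasis (B : mbasis n) (j : B) : free_mod B := [ffun i => (i == j)%:R].

Variable B : mbasis n.
Implicit Types (f g : free_mod B) (m : 'X_{1..n}).

Definition hhomog (d : nat) f := forall j, f j != 0 -> homdeg j = d.

(* The term 'X_[u] * a_j has multidegree u + multideg j. *)
Definition mhomog m f :=
  forall j (u : 'X_{1..n}), u \in msupp (f j : R) -> (u + multideg j)%MM = m.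

(* The zero element is bigraded of every bidegree. *)
Definition bigraded d m f := hhomog d f /\ mhomog m f.

(* The scalar alpha_j in the expansion
     f = \sum_j alpha_j (m / multideg j) a_j
   of an element f of multidegree m; it is 0 when multideg j does not divide m, so
   that a truncated quotient 'X_[m - multideg j] always occurs with coefficient 0. *)
Definition coef m f (j : B) : k :=
  if (multideg j <= m)%MM then (f j : R)@_(m - multideg j) else 0.

Record is_complex (D : free_mod B -> free_mod B) : Prop := IsComplex {
  cpx_linear : linear D;
  cpx_hdegS : forall d f, hhomog d.+1 f -> hhomog d (D f);
  cpx_hdeg0 : forall f, hhomog 0 f -> D f = 0;
  cpx_mdeg : forall m f, mhomog m f -> mhomog m (D f);
  cpx_sq0 : forall f, D (D f) = 0
}.

Record is_dg_algebra (D : free_mod B -> free_mod B)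
    (mul : free_mod B -> free_mod B -> free_mod B) : Prop := IsDGAlgebra {
  dg_complex : is_complex D;
  dg_linearl : forall g, linear (fun f => mul f g);
  dg_linearr : forall f, linear (mul f);
  dg_unit : exists e, bigraded 0 0%MM e /\
    (forall f, mul e f = f /\ mul f e = f);
  dg_assoc : associative mul;
  dg_hdeg : forall d d' f g,
    hhomog d f -> hhomog d' g -> hhomog (d + d') (mul f g);
  dg_mdeg : forall m m' f g,
    mhomog m f -> mhomog m' g -> mhomog (m + m')%MM (mul f g);
  dg_leibniz : forall d d' f g, hhomog d f -> hhomog d' g ->
    D (mul f g) = mul (D f) g + ((-1) ^+ d : R) *: mul f (D g);
  dg_comm : forall d d' f g, hhomog d f -> hhomog d' g ->
    mul f g = ((-1) ^+ (d * d') : R) *: mul g f;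
  dg_sq0 : forall d f, hhomog d f -> odd d -> mul f f = 0
}.

(* The complex is exact in positive homological degrees, and its cokernel in
   degree 0 is R/I. A multigraded augmentation F_0 -> R/I is given by a lift
   eps to R, which exists since F_0 is free; only the values of eps on elements
   of homological degree 0 matter. *)
Definition is_resolution (D : free_mod B -> free_mod B) (I : R -> Prop) :=
  [/\ is_complex D,
      forall d f, hhomog d.+1 f -> D f = 0 ->
        exists2 g, hhomog d.+2 g & D g = f
    & exists eps : {linear free_mod B -> R^o},
      [/\ forall m f, hhomog 0 f -> mhomog m f ->
            forall u, u \in msupp (eps f : R) -> u = m,
          forall p : R, exists2 f, hhomog 0 f & I (p - eps f)
        & forall f, hhomog 0 f ->
            (I (eps f) <-> exists2 g, hhomog 1 g & D g = f)]].

End FreeModules.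

Arguments ebasis k {n B} j.

Section Taylor.
Variables (k : fieldType) (n r : nat) (B : 'I_r -> mbasis n).
Local Notation R := {mpoly k[n]}.

Definition lcm_mon (m : 'I_r -> 'X_{1..n}) : 'X_{1..n} :=
  \big[@mlcm n/0%MM]_(i < r) m i.

(* The basis a_{1,j_1} * ... * a_{r,j_r} of F_1 * ... * F_r. *)
Definition taylor_basis : mbasis n :=
  @MBasis n {dffun forall i : 'I_r, B i}
    (fun a => \sum_(i < r) homdeg (a i))%N
    (fun a => lcm_mon (fun i => multideg (a i))).

(* The module F_1 * ... * F_r, isomorphic to the tensor product of the F_i. *)
Definition taylor := free_mod k taylor_basis.

(* f_1 * ... * f_r for f_i of multidegree m_i: the element of multidegree
   [m_1, ..., m_r] with the same scalars as the tensor f_1 (x) ... (x) f_r. If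
   the f_i are basis elements it is the corresponding basis element. In general
   it is not the R-multilinear tensor, which need not be homogeneous of
   multidegree [m_1, ..., m_r]. *)
Definition star (m : 'I_r -> 'X_{1..n}) (f : forall i, free_mod k (B i)) :
    taylor :=
  \sum_(a : taylor_basis)
    ((\prod_(i < r) coef (m i) (f i) (a i)) *: 'X_[lcm_mon m - multideg a] : R)
      *: ebasis k a.

Section Differential.
Variable D : forall i, free_mod k (B i) -> free_mod k (B i).

(* The value of the differential at f_1 * ... * f_r, for f_i of bidegree
   (d_i, m_i). *)
Definition taylor_diff_star (d : 'I_r -> nat) (m : 'I_r -> 'X_{1..n})
    (f : forall i, free_mod k (B i)) : taylor :=
  \sum_(i < r) ((-1) ^+ (\sum_(i' < r | (i' < i)%N) d i')%N : R) *:
    \sum_(j : B i)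
      let m' := [eta m with i |-> multideg j] in
      (coef (m i) (D (f i)) j *: 'X_[lcm_mon m - lcm_mon m'] : R)
        *: star m' (dfwith f (ebasis k j)).

(* R-linear extension of the formula from basis elements; by homogeneity the
   formula then holds for all bigraded f_i. *)
Definition taylor_diff (u : taylor) : taylor :=
  \sum_(a : taylor_basis) (u a : R) *:
    taylor_diff_star (fun i => homdeg (a i)) (fun i => multideg (a i))
                     (fun i => ebasis k (a i)).
End Differential.

Section Product.
Variable mul : forall i, free_mod k (B i) -> free_mod k (B i) -> free_mod k (B i).

(* The value of the product at f_1 * ... * f_r and f'_1 * ... * f'_r, for f_i
   of bidegree (d_i, m_i) and f'_i of bidegree (d'_i, m'_i). *)
Definition taylor_mul_star
    (d : 'I_r -> nat) (m : 'I_r -> 'X_{1..n}) (f : forall i, free_mod k (B i))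
    (d' : 'I_r -> nat) (m' : 'I_r -> 'X_{1..n}) (f' : forall i, free_mod k (B i)) :
    taylor :=
  ((-1) ^+ (\sum_(i < r) d' i * \sum_(j < r | (i < j)%N) d j)%N : R) *:
  \sum_(a : taylor_basis)
    ((\prod_(i < r) coef (m i + m' i)%MM (mul (f i) (f' i)) (a i)) *:
       'X_[lcm_mon m + lcm_mon m' - lcm_mon (fun i => multideg (a i))] : R)
    *: ebasis k a.

(* R-bilinear extension of the formula from pairs of basis elements. *)
Definition taylor_mul (u v : taylor) : taylor :=
  \sum_(a : taylor_basis) \sum_(b : taylor_basis) ((u a : R) * (v b : R)) *:
    taylor_mul_star (fun i => homdeg (a i)) (fun i => multideg (a i))
                    (fun i => ebasis k (a i))
                    (fun i => homdeg (b i)) (fun i => multideg (b i))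
                    (fun i => ebasis k (b i)).
End Product.
End Taylor.

(* Main.v *)
(* Setting every variable to 1 is injective on the elements of a fixed
   multidegree, and it turns the generalized Taylor differential and product
   into the differential and the product (with Koszul signs) of the ordinary
   tensor product over R of the F_i: the two differ only by monomial factors.
   Since the Taylor operations preserve multidegrees, every DG algebra axiom
   for them, checked on basis elements, reduces to the same identity for pure
   tensors of homogeneous elements. *)
Require Import Defs.
From HB Require Import structures.
From mathcomp Require Import all_boot all_order all_algebra.
From mathcomp Require Import mpoly.

Set Implicit Arguments.
Unset Strict Implicit.
Unset Printing Implicit Defensive.

Import GRing.Theory.
Local Open Scope ring_scope.

(** * Evaluation at one and homogeneous elements of a free module *)

Section FreeModules.
Variables (k : fieldType) (n : nat).
Local Notation R := {mpoly k[n]}.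
Variable B : mbasis n.
Implicit Types (u v : free_mod k B) (m : 'X_{1..n}) (a : B).

(** The Taylor basis is graded by lcms, so an ordinary tensor of multihomogeneous elements need not
    be multihomogeneous in the Taylor module. Tensors are therefore never equated with Taylor
    elements; they only record values at one, and injectivity is applied between two elements
    produced by Taylor operations (or zero, or a basis element).

    Truncated subtraction occurs twice, and each time the meaningless value multiplies zero. Where a
    monomial quotient fails to exist, some scalar [coef] in front of it is 0. Where the homological
    degree of a factor would drop below 0, the differential of that factor is 0, and with it the
    whole tensor. *)

Definition at_one (p : R) : k := p.@[fun=> 1].

Lemma at_oneD p q : at_one (p + q) = at_one p + at_one q.
Proof. exact: mevalD. Qed.

Lemma at_oneM p q : at_one (p * q) = at_one p * at_one q.
Proof. exact: mevalM. Qed.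

Lemma at_oneZX c m : at_one (c *: 'X_[m]) = c.
Proof.
by rewrite /at_one mevalZ mevalX big1 ?mulr1 // => i _; rewrite expr1n.
Qed.

Definition ev u : {ffun B -> k^o} := [ffun a => at_one (u a)].

Lemma evD u v : ev (u + v) = ev u + ev v.
Proof. by apply/ffunP => a; rewrite !ffunE at_oneD. Qed.

Lemma evZ (p : R) u : ev (p *: u) = at_one p *: ev u.
Proof. by apply/ffunP => a; rewrite !ffunE at_oneM. Qed.

Lemma ev0 : ev 0 = 0.
Proof. by apply/ffunP => a; rewrite !ffunE /at_one meval0. Qed.

Lemma ev_sum (I : Type) (s : seq I) (P : pred I) (F : I -> free_mod k B) :
  ev (\sum_(i <- s | P i) F i) = \sum_(i <- s | P i) ev (F i).
Proof. exact: (big_morph ev evD ev0). Qed.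

Lemma free_mod_sum u : u = \sum_a (u a : R) *: ebasis k a.
Proof.
apply/ffunP => a; rewrite sum_ffunE (bigD1 a) //= ffunE ffunE eqxx big1 ?addr0.
  by rewrite /GRing.scale /= mulr1.
by move=> b ba; rewrite !ffunE eq_sym (negbTE ba) /GRing.scale /= mulr0.
Qed.

Lemma mhomogP m u : mhomog m u ->
  forall a, u a = coef m u a *: 'X_[m - multideg a] :> R.
Proof.
move=> hu a; apply/mpolyP => w; rewrite mcoeffZ mcoeffX /coef.
case: (boolP (w \in msupp (u a : R))) => [wu|wNu].
  rewrite -(hu _ _ wu) lem_addl addmK eqxx mulr1 //.
case: eqP wNu => [<-|_] wNu; last by rewrite mulr0 memN_msupp_eq0.
by rewrite mulr1 memN_msupp_eq0 // if_same.
Qed.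

Lemma coef_ev m u a : mhomog m u -> coef m u a = ev u a.
Proof. by move=> hu; rewrite ffunE (mhomogP hu a) at_oneZX. Qed.

(** Each coordinate is a scalar times the one monomial fixed by [m] and the basis element, so its
    value at one determines it. The common [m] is essential: $a_j$ and $x_1 a_j$ have the same
    value. *)
Lemma ev_inj m u v : mhomog m u -> mhomog m v -> ev u = ev v -> u = v.
Proof.
move=> hu hv uv; apply/ffunP => a.
by rewrite (mhomogP hu) (mhomogP hv) !coef_ev // uv.
Qed.

(** A coordinate that vanishes in [v] has value 0 at one, hence vanishes in [u]. In the applications
    [v] is built from ordinary tensors and carries no multidegree of its own. *)
Lemma hhomog_ev d m u v : mhomog m u -> hhomog d v -> ev u = ev v -> hhomog d u.
Proof.
move=> hu hv uv a ua; apply: hv; apply: contraNneq ua => va.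
rewrite (mhomogP hu) coef_ev // uv ffunE va /at_one meval0 scale0r //.
Qed.

Lemma mhomog0 m : mhomog m (0 : free_mod k B).
Proof. by move=> a w; rewrite ffunE msupp0. Qed.

Lemma mhomogD m u v : mhomog m u -> mhomog m v -> mhomog m (u + v).
Proof.
move=> hu hv a w; rewrite ffunE => /msuppD_le; rewrite mem_cat.
by case/orP => [/hu|/hv].
Qed.

Lemma mhomogZ m m' (p : R) u :
  (forall w, w \in msupp p -> (w + m)%MM = m') ->
  mhomog m u -> mhomog m' (p *: u).
Proof.
move=> hp hu a w; rewrite ffunE => /msuppM_le /allpairsP [[x y] /= [px uy ->]].
by rewrite -addmA (hu _ _ uy) hp.
Qed.

(** Divisibility is asked only for a nonzero scalar: [m' - m] is truncated, and the scalars that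
    occur vanish where the quotient does not exist. *)
Lemma mhomogZX m m' c u : (c != 0 -> (m <= m')%MM) ->
  mhomog m u -> mhomog m' ((c *: 'X_[m' - m] : R) *: u).
Proof.
move=> cm; apply: mhomogZ => w; rewrite mcoeff_msupp mcoeffZ mcoeffX.
case: (_ =P w) => [<-|_]; last by rewrite mulr0 eqxx.
by rewrite mulr1 => /cm; apply: submK.
Qed.

Lemma mhomog_sum m (I : Type) (s : seq I) (P : pred I) (F : I -> free_mod k B) :
  (forall i, P i -> mhomog m (F i)) -> mhomog m (\sum_(i <- s | P i) F i).
Proof.
move=> hF; elim/big_rec: _ => [|i u Pi]; first exact: mhomog0.
exact/mhomogD/hF.
Qed.

Lemma mhomog_sign m N u : mhomog m u -> mhomog m ((-1) ^+ N *: u).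
Proof.
apply: mhomogZ => w; rewrite -signr_odd.
by case: odd; rewrite ?expr1 ?expr0 ?(perm_mem (msuppN _)) -mpolyC1 msupp1 inE
  => /eqP ->; rewrite add0m.
Qed.

Lemma mhomog_ebasis a : mhomog (multideg a) (ebasis k a).
Proof.
move=> b w; rewrite ffunE; case: eqP => [->|_]; last by rewrite msupp0.
by rewrite -mpolyC1 msupp1 inE => /eqP ->; rewrite add0m.
Qed.

Lemma hhomog0 d : hhomog d (0 : free_mod k B).
Proof. by move=> a; rewrite ffunE eqxx. Qed.

Lemma hhomogD d u v : hhomog d u -> hhomog d v -> hhomog d (u + v).
Proof.
move=> hu hv a; rewrite ffunE; have [->|/hu //] := eqVneq (u a) 0.
by rewrite add0r => /hv.
Qed.

Lemma hhomogZ d (p : R) u : hhomog d u -> hhomog d (p *: u).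
Proof.
by move=> hu a; rewrite ffunE => pu; apply: hu; apply: contraNneq pu => ->;
  rewrite scaler0.
Qed.

Lemma hhomog_sum d (I : Type) (s : seq I) (P : pred I) (F : I -> free_mod k B) :
  (forall i, P i -> hhomog d (F i)) -> hhomog d (\sum_(i <- s | P i) F i).
Proof.
move=> hF; elim/big_rec: _ => [|i u Pi]; first exact: hhomog0.
exact/hhomogD/hF.
Qed.

Lemma hhomog_ebasis a : hhomog (homdeg a) (ebasis k a).
Proof. by move=> b; rewrite ffunE; case: (b =P a) => [->|_]; rewrite ?eqxx. Qed.


Lemma linear_coord (C : mbasis n) (L : free_mod k B -> free_mod k C) u :
  linear L -> L u = \sum_a (u a : R) *: L (ebasis k a).
Proof.
move=> linL; pose F : {linear free_mod k B -> free_mod k C} :=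
  HB.pack L (GRing.isLinear.Build R (free_mod k B) (free_mod k C) _ L linL).
rewrite -[L]/(F : _ -> _) {1}(free_mod_sum u) linear_sum.
by apply: eq_bigr => a _; rewrite linearZ.
Qed.

(** Restricting to the support of [u] matters for signs: if [u] has homological degree [d], the
    basis elements that occur have degree [d] too, so $(-1)^d$ is the sign of the identity on each
    of them. *)
Lemma linear_ext (C : mbasis n) (L L' : free_mod k B -> free_mod k C) u :
  linear L -> linear L' ->
  (forall a, u a != 0 -> L (ebasis k a) = L' (ebasis k a)) -> L u = L' u.
Proof.
move=> linL linL' LL'; rewrite (linear_coord _ linL) (linear_coord _ linL').
apply: eq_bigr => a _; have [->|/LL' -> //] := eqVneq (u a) 0.
by rewrite !scale0r.
Qed.
End FreeModules.

(** * Linear maps under the gradings and under evaluation *)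

Section LinearMapsHomogeneous.
Variables (k : fieldType) (n : nat) (B C : mbasis n).
Local Notation R := {mpoly k[n]}.
Variable L : free_mod k B -> free_mod k C.
Hypothesis linL : linear L.
Implicit Types (u : free_mod k B).

Lemma linear_sumZ (I : finType) (c : I -> R) (x : I -> free_mod k B) :
  L (\sum_i c i *: x i) = \sum_i c i *: L (x i).
Proof.
pose F : {linear free_mod k B -> free_mod k C} :=
  HB.pack L (GRing.isLinear.Build R (free_mod k B) (free_mod k C) _ L linL).
rewrite -[L]/(F : _ -> _) linear_sum.
by apply: eq_bigr => i _; rewrite linearZ.
Qed.

Lemma linear_scal (p : R) u : L (p *: u) = p *: L u.
Proof.
pose F : {linear free_mod k B -> free_mod k C} :=
  HB.pack L (GRing.isLinear.Build R (free_mod k B) (free_mod k C) _ L linL).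
exact: (linearZ_LR F).
Qed.

Lemma linear_hhomog d u :
  (forall a, u a != 0 -> hhomog d (L (ebasis k a))) -> hhomog d (L u).
Proof.
move=> hL; rewrite (linear_coord _ linL); apply: hhomog_sum => a _.
have [->|/hL ?] := eqVneq (u a) 0; last exact: hhomogZ.
by rewrite scale0r; apply: hhomog0.
Qed.

Lemma linear_mhomog m m' u :
  (forall a, mhomog (m' + multideg a)%MM (L (ebasis k a))) ->
  mhomog m u -> mhomog (m' + m)%MM (L u).
Proof.
move=> hL hu; rewrite (linear_coord _ linL); apply: mhomog_sum => a _.
apply: mhomogZ (hL a) => w /hu <-.
by rewrite addmA [(w + m')%MM]addmC -addmA.
Qed.

(** Evaluation at one is a ring morphism, so an R-linear map descends to coordinates over k. Through
    this, a result known only after evaluation can be fed into a further differential or product. *)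
Lemma linear_ev u v : ev u = ev v -> ev (L u) = ev (L v).
Proof.
move=> uv; rewrite (linear_coord u linL) (linear_coord v linL).
rewrite ev_sum [RHS]ev_sum; apply: eq_bigr => a _.
by rewrite evZ [RHS]evZ; congr (_ *: _); move/ffunP/(_ a): uv; rewrite !ffunE.
Qed.

Lemma ev_linearZ u v w (p : R) :
  ev u = ev (p *: v) -> ev (L v) = ev w -> ev (L u) = ev (p *: w).
Proof.
by move=> uv vw; rewrite (linear_ev uv) linear_scal evZ vw -evZ.
Qed.

Lemma ev_linear_sumZ (I : finType) (c : I -> R) u (x : I -> free_mod k B)
    (y : I -> free_mod k C) :
  ev u = ev (\sum_i c i *: x i) -> (forall i, ev (L (x i)) = ev (y i)) ->
  ev (L u) = ev (\sum_i c i *: y i).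
Proof.
move=> ux xy; rewrite (linear_ev ux) linear_sumZ ev_sum [RHS]ev_sum.
by apply: eq_bigr => i _; rewrite evZ xy -evZ.
Qed.
End LinearMapsHomogeneous.

(** * Reduction of the DG algebra axioms to basis elements *)

Section DGCriterion.
Variables (k : fieldType) (n : nat) (B : mbasis n).
Local Notation R := {mpoly k[n]}.
Local Notation M := (free_mod k B).
Local Notation e := (ebasis k).
Implicit Types (a b c : B).

Lemma linear_comp (f g : M -> M) :
  linear f -> linear g -> linear (fun u => f (g u)).
Proof. by move=> lf lg p u v; rewrite lg lf. Qed.

Lemma linear_add (f g : M -> M) :
  linear f -> linear g -> linear (fun u => f u + g u).
Proof. by move=> lf lg p u v; rewrite lf lg scalerDr addrACA. Qed.

Lemma linear_scale (q : R) (f : M -> M) :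
  linear f -> linear (fun u => q *: f u).
Proof. by move=> lf p u v; rewrite lf scalerDr !scalerA mulrC. Qed.

(** Leibniz and commutativity are asked of elements homogeneous for the homological degree alone, on
    which evaluation at one is not injective. Basis elements are homogeneous for both gradings, and
    all axioms except the vanishing of odd squares are linear in each argument. *)
Lemma dg_algebra_of_basis (D : M -> M) (mul : M -> M -> M) (one : M) :
  linear D -> (forall v, linear (mul^~ v)) -> (forall u, linear (mul u)) ->
  (forall a d, homdeg a = d.+1 -> hhomog d (D (e a))) ->
  (forall a, homdeg a = 0%N -> D (e a) = 0) ->
  (forall a, mhomog (multideg a) (D (e a))) ->
  (forall a, D (D (e a)) = 0) ->
  bigraded 0 0%MM one ->
  (forall a, mul one (e a) = e a) -> (forall a, mul (e a) one = e a) ->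
  (forall a b c, mul (e a) (mul (e b) (e c)) = mul (mul (e a) (e b)) (e c)) ->
  (forall a b, hhomog (homdeg a + homdeg b) (mul (e a) (e b))) ->
  (forall a b, mhomog (multideg a + multideg b)%MM (mul (e a) (e b))) ->
  (forall a b, D (mul (e a) (e b)) = mul (D (e a)) (e b) +
     ((-1) ^+ homdeg a : R) *: mul (e a) (D (e b))) ->
  (forall a b, mul (e a) (e b) =
     ((-1) ^+ (homdeg a * homdeg b) : R) *: mul (e b) (e a)) ->
  (forall a, odd (homdeg a) -> mul (e a) (e a) = 0) ->
  is_dg_algebra D mul.
Proof.
move=> linD linl linr DS D0 Dm DD one_bi mul1e mule1 eA ehd emd eL eC eS.
have lin0 : linear (fun _ : M => 0 : M).
  by move=> p u v; rewrite scaler0 addr0.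
have comm d d' f g : hhomog d f -> hhomog d' g ->
    mul f g = ((-1) ^+ (d * d') : R) *: mul g f.
  move=> hf hg; apply: (linear_ext (L := mul^~ g)
                     (L' := fun f => ((-1) ^+ (d * d') : R) *: mul g f)) => //.
    exact: linear_scale.
  move=> a /hf <-; apply: (linear_ext (L := mul (e a))
    (L' := fun g => ((-1) ^+ (homdeg a * d') : R) *: mul g (e a))) => //.
    exact: linear_scale.
  by move=> b /hg <-.
split=> //.
- split=> //.
  + move=> d f hf; apply: linear_hhomog => // a /hf; exact: DS.
  + move=> f hf; apply: (linear_ext (L := D) (L' := fun=> 0)) => // a /hf.
    exact: D0.
  + move=> m f hf; rewrite -[m]add0m; apply: linear_mhomog => // a.
    by rewrite add0m.
  + move=> f; apply: (linear_ext (L := fun u => D (D u)) (L' := fun=> 0)) => //.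
    exact: linear_comp.
- exists one; split=> // f; split;
    [ apply: (linear_ext (L := mul one) (L' := fun u : M => u))
    | apply: (linear_ext (L := mul^~ one) (L' := fun u : M => u))] => //.
- move=> f g h.
  apply: (linear_ext (L := fun f => mul f (mul g h))
                     (L' := fun f => mul (mul f g) h)) => //.
    exact: (linear_comp (linl _) (linl _)).
  move=> a _.
  apply: (linear_ext (L := fun g => mul (e a) (mul g h))
                     (L' := fun g => mul (mul (e a) g) h)) => //.
  + exact: (linear_comp (linr _) (linl _)).
  + exact: (linear_comp (linl _) (linr _)).
  move=> b _; apply: (linear_ext (L := fun h => mul (e a) (mul (e b) h))
                     (L' := fun h => mul (mul (e a) (e b)) h)) => //.
  exact: (linear_comp (linr _) (linr _)).
- move=> d d' f g hf hg; apply: (linear_hhomog (linl g)) => a /hf <-.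
  by apply: (linear_hhomog (linr (e a))) => b /hg <-.
- move=> m m' f g hf hg; rewrite addmC.
  apply: (linear_mhomog (linl g)) hf => a; rewrite addmC.
  by apply: (linear_mhomog (linr (e a))) hg => b.
- move=> d d' f g hf hg.
  apply: (linear_ext (L := fun f => D (mul f g))
    (L' := fun f => mul (D f) g + ((-1) ^+ d : R) *: mul f (D g))) => //.
  + exact: (linear_comp linD (linl _)).
  + apply: linear_add (linear_scale _ (linl _)).
    exact: (linear_comp (linl _) linD).
  move=> a /hf <-.
  apply: (linear_ext (L := fun g => D (mul (e a) g))
   (L' := fun g => mul (D (e a)) g + ((-1) ^+ homdeg a : R) *: mul (e a) (D g)))
   => //.
  + exact: (linear_comp linD (linr _)).
  + apply: linear_add (linear_scale _ _) => //.
    exact: (linear_comp (linr _) linD).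
(* The elements of odd degree with square 0 are closed under addition because
   they anticommute. *)
- move=> d f hf odd_d; rewrite (free_mod_sum f).
  pose P u := hhomog d u /\ mul u u = 0.
  have mul0 g : mul 0 g = 0.
    by rewrite (linear_coord _ (linl g)) big1 // => a _; rewrite ffunE scale0r.
  suff [] : P (\sum_a (f a : R) *: e a) by [].
  apply: big_ind => [|x y [hx xx] [hy yy]|a _].
  + by split; [exact: hhomog0 | exact: mul0].
  + split; first exact: hhomogD.
    have addl u v g : mul (u + v) g = mul u g + mul v g.
      by have := linl g 1 u v; rewrite !scale1r.
    have addr u v g : mul g (u + v) = mul g u + mul g v.
      by have := linr g 1 u v; rewrite !scale1r.
    rewrite addl !addr xx yy add0r addr0 (comm _ _ _ _ hx hy).
    by rewrite -signr_odd oddM odd_d expr1 scaleN1r addNr.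
  + have [->|fa] := eqVneq (f a) 0.
      by rewrite scale0r; split; [exact: hhomog0 | exact: mul0].
    have da := hf _ fa.
    split; first by rewrite -da; apply/hhomogZ/hhomog_ebasis.
    have scl p u g : mul (p *: u) g = p *: mul u g.
      by have := linl g p u 0; rewrite mul0 !addr0.
    rewrite scl (linear_coord _ (linr _)) big1 ?scaler0 // => b _.
    rewrite !ffunE; case: (b =P a) => [->|_].
      by rewrite eS ?scaler0 // da.
    by rewrite scaler0 scale0r.
Qed.
End DGCriterion.

(** * Ordinary tensors and their comparison with [star] *)

Section Tensor.
Variables (k : fieldType) (n r : nat) (B : 'I_r -> mbasis n).
Local Notation R := {mpoly k[n]}.
Local Notation T := (taylor_basis B).
Local Notation fam := (forall i, free_mod k (B i)).
Local Notation e := (ebasis k).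
Implicit Types (f g h : fam) (a b : T) (i j : 'I_r).
Implicit Types (d : 'I_r -> nat) (m : 'I_r -> 'X_{1..n}).

Lemma le_lcm_mon m i : (m i <= lcm_mon m)%MM.
Proof.
rewrite /lcm_mon; elim: index_enum (mem_index_enum i) => // j s IHs.
rewrite inE big_cons => /orP[/eqP <-|/IHs]; first exact: lem_mlcml.
by move/lepm_trans; apply; apply: lem_mlcmr.
Qed.

Lemma lcm_mon_le m (w : 'X_{1..n}) :
  (forall i, (m i <= w)%MM) -> (lcm_mon m <= w)%MM.
Proof.
move=> mw; rewrite /lcm_mon; elim/big_rec: _ => [|i x _ xw].
  by apply/mnm_lepP => j; rewrite mnm0E.
by rewrite lem_mlcm mw.
Qed.

(** The coordinates of $f_1 \otimes \cdots \otimes f_r$ over R. Unlike [star] it is R-multilinear;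
    the two agree only after evaluation at one. *)
Definition tens f : free_mod k T := [ffun a : T => \prod_i (f i (a i) : R)].

Lemma tens_ext f g : (forall i, f i = g i) -> tens f = tens g.
Proof.
by move=> fg; apply/ffunP => a; rewrite !ffunE; apply: eq_bigr => i _;
  rewrite fg.
Qed.

Lemma tens_ebasis a : tens (fun i => e (a i)) = e a.
Proof.
apply/ffunP => b; rewrite !ffunE; case: (b =P a) => [->|ba].
  by rewrite big1 // => i _; rewrite ffunE eqxx.
case: (pickP (fun i => b i != a i)) => [i nba|eqba].
  by rewrite (bigD1 i) //= ffunE (negbTE nba) mul0r.
by case: ba; apply/ffunP => i; move/eqP: (negbFE (eqba i)).
Qed.

(** The index sets depend on [i], so the sums are moved into the disjoint union of the [B i], where
    distributivity for ordinary functions applies; functions whose [i]-th value lies in the [i]-th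
    summand are the dependent functions. *)
Lemma prod_sum_dffun (F : forall i, B i -> R) :
  \prod_i \sum_(x : B i) F i x = \sum_(a : T) \prod_i F i (a i).
Proof.
pose T_ i : finType := B i; pose P i := [ffun x : T_ i => F i x].
transitivity (\prod_i \sum_(x : T_ i) P i x).
  by apply: eq_bigr => i _; apply: eq_bigr => x _; rewrite ffunE.
rewrite (eq_bigr _ (fun i _ => big_tag (fun j (x : T_ j) => P j x) i)).
rewrite bigA_distr_big_dep -(big_fprod _ _ P).
rewrite (reindex (@fprod_of_dffun _ T_)); last first.
  by apply: onW_bij; exists (@dffun_of_fprod _ T_);
    [exact: fprod_of_dffunK | exact: dffun_of_fprodK].
apply: eq_bigr => a _; apply: eq_bigr => i _; rewrite ffunE.
by rewrite -{2}(fprod_of_dffunK a) ffunE.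
Qed.

Lemma tens_sum (c : forall i, B i -> R) (g : forall i, B i -> free_mod k (B i)) :
  tens (fun i => \sum_(x : B i) c i x *: g i x) =
  \sum_(a : T) (\prod_i c i (a i)) *: tens (fun i => g i (a i)).
Proof.
apply/ffunP => b; rewrite ffunE sum_ffunE.
under eq_bigr do rewrite sum_ffunE.
rewrite prod_sum_dffun; apply: eq_bigr => a _.
rewrite !ffunE /GRing.scale /= -big_split.
by apply: eq_bigr => i _; rewrite ffunE.
Qed.

Lemma tensE i f a :
  tens f a = f i (a i) * \prod_(j | j != i) (f j (a j) : R) :> R.
Proof. by rewrite ffunE (bigD1 i). Qed.

Lemma tens_eq0 f i : f i = 0 -> tens f = 0.
Proof.
by move=> fi0; apply/ffunP => a; rewrite (tensE i) fi0 !ffunE mul0r.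
Qed.

Lemma tens_add i f g h : f i = g i + h i ->
  (forall j, j != i -> f j = g j) -> (forall j, j != i -> f j = h j) ->
  tens f = tens g + tens h.
Proof.
move=> fi fg fh; apply/ffunP => a; rewrite [RHS]ffunE !(tensE i) fi ffunE.
rewrite mulrDl; congr (_ * _ + _ * _); apply: eq_bigr => j ji.
  by rewrite fg.
by rewrite fh.
Qed.

Lemma tens_scale (p : 'I_r -> R) f :
  tens (fun i => p i *: f i) = (\prod_i p i) *: tens f.
Proof.
apply/ffunP => a; rewrite !ffunE /GRing.scale /= -big_split.
by apply: eq_bigr => i _; rewrite ffunE.
Qed.

Lemma tens_scale1 i (p : R) f g : f i = p *: g i ->
  (forall j, j != i -> f j = g j) -> tens f = p *: tens g.
Proof.
move=> fi fg; apply/ffunP => a; rewrite [RHS]ffunE !(tensE i) fi ffunE.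
rewrite /GRing.scale /= -mulrA; congr (_ * (_ * _)); apply: eq_bigr => j ji.
by rewrite fg.
Qed.

Lemma hhomog_tens d f : (forall i, hhomog (d i) (f i)) ->
  hhomog (\sum_i d i) (tens f).
Proof.
move=> hf a; rewrite ffunE => fa; apply: eq_bigr => i _; apply: hf.
by apply: contraNneq fa => fi; rewrite (bigD1 i) //= fi mul0r.
Qed.

Lemma sum_ebasisE (C : mbasis n) (c : C -> R) :
  (\sum_(x : C) c x *: e x) = [ffun x => c x] :> free_mod k C.
Proof.
by rewrite [RHS]free_mod_sum; apply: eq_bigr => x _; rewrite ffunE.
Qed.

(** A nonzero scalar forces each [multideg (a i)] to divide [m i], hence the lcm to divide the lcm,
    and the exponent is a true quotient. *)
Lemma mhomog_star m f : mhomog (lcm_mon m) (star m f).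
Proof.
apply: mhomog_sum => a _; apply: mhomogZX; last exact: mhomog_ebasis.
move=> ca; apply: lcm_mon_le => i; apply: lepm_trans (le_lcm_mon m i).
apply: contraNT ca => lea.
by rewrite (bigD1 i) //= /coef (negbTE lea) mul0r.
Qed.

Lemma at_one_prod (F : 'I_r -> R) : at_one (\prod_i F i) = \prod_i at_one (F i).
Proof. exact: (big_morph _ (@at_oneM k n) (meval1 _)). Qed.

Lemma ev_star m f : (forall i, mhomog (m i) (f i)) -> ev (star m f) = ev (tens f).
Proof.
move=> hf; rewrite /star sum_ebasisE; apply/ffunP => a.
rewrite !ffunE at_oneZX at_one_prod; apply: eq_bigr => i _.
by rewrite coef_ev // ffunE.
Qed.
End Tensor.

(** * The Taylor differential and product after evaluation at one *)

Section TaylorOperations.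
Variables (k : fieldType) (n r : nat) (B : 'I_r -> mbasis n).
Local Notation R := {mpoly k[n]}.
Local Notation T := (taylor_basis B).
Local Notation fam := (forall i, free_mod k (B i)).
Local Notation e := (ebasis k).
Implicit Types (f g h : fam) (a b : T) (i j : 'I_r).
Implicit Types (d : 'I_r -> nat) (m : 'I_r -> 'X_{1..n}).

Lemma tens_expand i f g (c : B i -> R) (x : B i -> free_mod k (B i)) :
  f i = \sum_(y : B i) c y *: x y -> (forall j, j != i -> f j = g j) ->
  tens f = \sum_(y : B i) c y *: tens (dfwith g (x y)).
Proof.
move=> fi fg; apply/ffunP => a; rewrite (tensE i) fi !sum_ffunE mulr_suml.
apply: eq_bigr => y _; rewrite [in RHS]ffunE (tensE i) dfwith_in ffunE.
rewrite /GRing.scale /= -mulrA; congr (_ * (_ * _)); apply: eq_bigr => j ji.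
by rewrite fg // dfwith_out // eq_sym.
Qed.

Lemma tens_homdeg d f a : (forall i, hhomog (d i) (f i)) ->
  tens f a != 0 -> forall i, homdeg (a i) = d i.
Proof.
move=> hf fa i; apply: hf; apply: contraNneq fa => fi.
by rewrite (tensE i) fi mul0r.
Qed.

Lemma coef_neq0 m f i (x : B i) : coef (m i) (f i) x != 0 ->
  (multideg x <= m i)%MM.
Proof. by rewrite /coef; case: ifP => //; rewrite eqxx. Qed.

Lemma sum_scale_ebasis a (F : T -> free_mod k T) :
  \sum_(b : T) (e a b : R) *: F b = F a.
Proof.
rewrite (bigD1 a) //= ffunE eqxx scale1r big1 ?addr0 // => b ba.
by rewrite ffunE (negbTE ba) scale0r.
Qed.

(* [before d i] is the Koszul exponent for moving an operator of degree 1 past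
   f_1, ..., f_(i-1), and [crossing d d'] the one for interleaving
   f_1 * ... * f_r with f'_1 * ... * f'_r; [d] and [d'] are the degrees. *)
Definition before d i := (\sum_(i' < r | (i' < i)%N) d i')%N.

Definition crossing d d' :=
  (\sum_(i < r) d' i * \sum_(j < r | (i < j)%N) d j)%N.

Section Differential.
Variable D : forall i, free_mod k (B i) -> free_mod k (B i).
Hypothesis linD : forall i, linear (@D i).
Hypothesis mdegD : forall i w (x : free_mod k (B i)),
  mhomog w x -> mhomog w (D x).

Definition slot i f : fam := fun j => if j == i then D (f j) else f j.

Lemma taylor_diff_linear : linear (taylor_diff D).
Proof.
move=> p u v; rewrite /taylor_diff scaler_sumr -big_split.
by apply: eq_bigr => a _; rewrite !ffunE scalerDl scalerA.
Qed.

Lemma taylor_diff_ebasis a : taylor_diff D (e a) =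
  taylor_diff_star D (fun i => homdeg (a i)) (fun i => multideg (a i))
    (fun i => e (a i)).
Proof.
exact: (sum_scale_ebasis a (fun a => taylor_diff_star D
  (fun i => homdeg (a i)) (fun i => multideg (a i)) (fun i => e (a i)))).
Qed.

Lemma mhomog_dfwith m f i (x : B i) : (forall i, mhomog (m i) (f i)) ->
  forall j, mhomog ([eta m with i |-> multideg x] j) (dfwith f (e x) j).
Proof.
move=> hf j; case: dfwithP => [|{}j ij] /=; first by
  rewrite eqxx; apply: mhomog_ebasis.
by rewrite eq_sym (negbTE ij).
Qed.

Lemma mhomog_taylor_diff_star d m f :
  mhomog (lcm_mon m) (taylor_diff_star D d m f).
Proof.
apply: mhomog_sum => i _; apply: mhomog_sign; apply: mhomog_sum => x _.
apply: mhomogZX; last exact: mhomog_star.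
move=> cx; apply: lcm_mon_le => j /=; case: (j =P i) => [_|_].
  exact: lepm_trans (coef_neq0 (f := fun i => D (f i)) cx) (le_lcm_mon m i).
exact: le_lcm_mon.
Qed.

Lemma ev_taylor_diff_star d m f : (forall i, mhomog (m i) (f i)) ->
  ev (taylor_diff_star D d m f) =
  ev (\sum_i ((-1) ^+ before d i : R) *: tens (slot i f)).
Proof.
move=> hf; rewrite /taylor_diff_star !ev_sum; apply: eq_bigr => i _.
rewrite !evZ; congr (_ *: _).
rewrite (tens_expand (i := i) (g := f) (c := D (f i)) (x := fun x => e x));
  first last.
- by move=> j ji; rewrite /slot (negbTE ji).
- by rewrite /slot eqxx; apply: free_mod_sum.
rewrite !ev_sum; apply: eq_bigr => x _; rewrite !evZ at_oneZX.
rewrite ev_star; last exact: mhomog_dfwith.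
by rewrite coef_ev ?ffunE //; apply: mdegD.
Qed.

(** The signs in [taylor_diff] come from the degrees of basis elements. On the support of the tensor
    these equal the [d i], so the sign leaves the sum and the rest resums by multilinearity. *)
Lemma taylor_diff_tens d f u : (forall i, hhomog (d i) (f i)) ->
  ev u = ev (tens f) ->
  ev (taylor_diff D u) = ev (\sum_i ((-1) ^+ before d i : R) *: tens (slot i f)).
Proof.
move=> hf /(linear_ev taylor_diff_linear) ->; rewrite /taylor_diff ev_sum.
under eq_bigr => a _.
  rewrite evZ ev_taylor_diff_star -?evZ; last by move=> i; apply: mhomog_ebasis.
  rewrite scaler_sumr; over.
rewrite -ev_sum exchange_big; congr ev; apply: eq_bigr => i _ /=.
transitivity (\sum_(a : T) ((-1) ^+ before d i : R) *:
  ((tens f a : R) *: tens (slot i (fun j => e (a j))))).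
  apply: eq_bigr => a _; have [->|fa] := eqVneq (tens f a) 0.
    by rewrite !scale0r scaler0.
  rewrite !scalerA mulrC; congr (_ ^+ _ * _ *: _).
  by apply: eq_bigr => j _; apply: tens_homdeg fa _.
rewrite -scaler_sumr; congr (_ *: _).
rewrite -(tens_ext (f := fun j => \sum_(x : B j) (f j x : R) *:
   (if j == i then D (e x) else e x)) (g := slot i f)).
  by rewrite tens_sum; apply: eq_bigr => a _; rewrite ffunE.
move=> j; rewrite /slot; case: eqP => _; last exact/esym/free_mod_sum.
exact/esym/linear_coord.
Qed.
End Differential.

Section Product.
Variable mul : forall i, free_mod k (B i) -> free_mod k (B i) -> free_mod k (B i).
Hypothesis linl : forall i v, linear (fun u => @mul i u v).
Hypothesis linr : forall i u, linear (@mul i u).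
Hypothesis mdeg_mul : forall i w w' (x y : free_mod k (B i)),
  mhomog w x -> mhomog w' y -> mhomog (w + w')%MM (mul x y).

Lemma taylor_mul_linearl v : linear (fun u => taylor_mul mul u v).
Proof.
move=> p u u'; rewrite /taylor_mul scaler_sumr -big_split.
apply: eq_bigr => a _; rewrite scaler_sumr -big_split.
by apply: eq_bigr => b _; rewrite !ffunE mulrDl scalerDl scalerA mulrA.
Qed.

Lemma taylor_mul_linearr u : linear (taylor_mul mul u).
Proof.
move=> p v v'; rewrite /taylor_mul scaler_sumr -big_split.
apply: eq_bigr => a _; rewrite scaler_sumr -big_split.
apply: eq_bigr => b _; rewrite !ffunE mulrDr scalerDl scalerA.
by rewrite /GRing.scale /= mulrCA.
Qed.

Lemma taylor_mul_ebasis a b : taylor_mul mul (e a) (e b) =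
  taylor_mul_star mul
    (fun i => homdeg (a i)) (fun i => multideg (a i)) (fun i => e (a i))
    (fun i => homdeg (b i)) (fun i => multideg (b i)) (fun i => e (b i)).
Proof.
rewrite /taylor_mul -[RHS](sum_scale_ebasis a (fun a => taylor_mul_star mul
  (fun i => homdeg (a i)) (fun i => multideg (a i)) (fun i => e (a i))
  (fun i => homdeg (b i)) (fun i => multideg (b i)) (fun i => e (b i)))).
apply: eq_bigr => c _; rewrite -[in RHS](sum_scale_ebasis b (fun b =>
  taylor_mul_star mul
  (fun i => homdeg (c i)) (fun i => multideg (c i)) (fun i => e (c i))
  (fun i => homdeg (b i)) (fun i => multideg (b i)) (fun i => e (b i)))).
by rewrite scaler_sumr; apply: eq_bigr => c' _; rewrite scalerA.
Qed.

(** The fraction in the product formula is a monomial wherever its scalar is nonzero: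
    [multideg (a i)] then divides $m_i m'_i$, which divides the product of the two lcms for every
    [i]. *)
Lemma mhomog_taylor_mul_star d m f d' m' f' :
  mhomog (lcm_mon m + lcm_mon m')%MM (taylor_mul_star mul d m f d' m' f').
Proof.
apply: mhomog_sign; apply: mhomog_sum => a _.
apply: mhomogZX; last exact: mhomog_ebasis.
move=> ca; apply: lcm_mon_le => i.
apply: (lepm_trans (m2 := (m i + m' i)%MM)); last first.
  by apply/mnm_lepP => l; rewrite !mnmDE leq_add //;
    apply/mnm_lepP; apply: le_lcm_mon.
apply: contraNT ca => lea.
by rewrite (bigD1 i) //= /coef (negbTE lea) mul0r.
Qed.

Lemma ev_taylor_mul_star d m f d' m' f' :
  (forall i, mhomog (m i) (f i)) -> (forall i, mhomog (m' i) (f' i)) ->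
  ev (taylor_mul_star mul d m f d' m' f') =
  ev (((-1) ^+ crossing d d' : R) *: tens (fun i => mul (f i) (f' i))).
Proof.
move=> hf hf'; rewrite /taylor_mul_star !evZ; congr (_ *: _).
rewrite sum_ebasisE; apply/ffunP => a.
rewrite !ffunE at_oneZX at_one_prod; apply: eq_bigr => i _.
by rewrite coef_ev ?ffunE //; apply: mdeg_mul.
Qed.

(** Signs are constant on the supports, as for the differential. Allowing any [u] and [v] with the
    values of tensors makes the result applicable to [star], in particular to the unit. *)
Lemma taylor_mul_tens d f d' f' u v :
  (forall i, hhomog (d i) (f i)) -> (forall i, hhomog (d' i) (f' i)) ->
  ev u = ev (tens f) -> ev v = ev (tens f') ->
  ev (taylor_mul mul u v) =
  ev (((-1) ^+ crossing d d' : R) *: tens (fun i => mul (f i) (f' i))).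
Proof.
move=> hf hf' /(linear_ev (taylor_mul_linearl v)) ->.
move=> /(linear_ev (taylor_mul_linearr (tens f))) ->.
rewrite /taylor_mul ev_sum.
under eq_bigr => a _.
  rewrite ev_sum.
  under eq_bigr => b _.
    rewrite evZ ev_taylor_mul_star -?evZ; try by move=> i; apply: mhomog_ebasis.
    over.
  rewrite -ev_sum; over.
rewrite -ev_sum; congr ev.
transitivity (\sum_(a : T) \sum_(b : T) ((-1) ^+ crossing d d' : R) *:
  ((tens f a : R) *: ((tens f' b : R) *: tens (fun i => mul (e (a i)) (e (b i)))))).
  apply: eq_bigr => a _; apply: eq_bigr => b _.
  have [->|fa] := eqVneq (tens f a) 0; first by rewrite mul0r !scale0r scaler0.
  have [->|fb] := eqVneq (tens f' b) 0.
    by rewrite mulr0 !scale0r !scaler0.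
  rewrite !scalerA; congr (_ *: _).
  rewrite [LHS]mulrC -[RHS]mulrA; congr (_ ^+ _ * _).
  apply: eq_bigr => j _; rewrite (tens_homdeg hf' fb); congr (_ * _)%N.
  by apply: eq_bigr => l _; apply: tens_homdeg fa _.
under eq_bigr => a _.
  rewrite -scaler_sumr -scaler_sumr.
  rewrite -(_ : tens (fun i => mul (e (a i)) (f' i)) = \sum_(b : T) _); first over.
  rewrite -(tens_ext (f := fun j => \sum_(x : B j) (f' j x : R) *: mul (e (a j)) (e x))
    (g := fun j => mul (e (a j)) (f' j))).
    by rewrite tens_sum; apply: eq_bigr => b _; rewrite ffunE.
  by move=> j; apply/esym/linear_coord.
rewrite -scaler_sumr; congr (_ *: _).
rewrite -(tens_ext (f := fun j => \sum_(x : B j) (f j x : R) *: mul (e x) (f' j))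
  (g := fun j => mul (f j) (f' j))).
  by rewrite tens_sum; apply: eq_bigr => a _; rewrite ffunE.
by move=> j; apply/esym/(linear_coord _ (linl _)).
Qed.
End Product.
End TaylorOperations.

(** * Parity of the Koszul exponents *)

Section Signs.
Variable r : nat.
Implicit Types (d : 'I_r -> nat) (i j : 'I_r).

(** The degrees after a differential in slot [i]. In degree 0 the predecessor is truncated,
    harmlessly: the differential is 0 there, and 0 has every degree. *)
Definition dec i d := fun j => if j == i then (d j).-1 else d j.

Lemma sum_dec i d (P : pred 'I_r) : (0 < d i)%N ->
  (\sum_(j | P j) d j = \sum_(j | P j) dec i d j + P i)%N.
Proof.
move=> di; case: (boolP (P i)) => Pi; last first.
  rewrite addn0; apply: eq_bigr => j Pj; rewrite /dec; case: eqP => // ji.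
  by rewrite -ji Pj in Pi.
rewrite !(bigD1 i Pi) /= addn1 {1}/dec eqxx -addSn prednK //; congr addn.
by apply: eq_bigr => j /andP[_ /negbTE ji]; rewrite /dec ji.
Qed.

Lemma before_dec_lt i j d : (0 < d i)%N -> (i < j)%N ->
  before d j = (before (dec i d) j).+1.
Proof. by move=> di ij; rewrite /before (sum_dec _ di) ij addn1. Qed.

Lemma before_dec_ge i j d : (j <= i)%N -> before (dec i d) j = before d j.
Proof.
move=> ji; apply: eq_bigr => l lj; rewrite /dec; case: eqP => // li.
by move: (leq_trans lj ji); rewrite li ltnn.
Qed.

Lemma beforeD d d' i :
  before (fun j => d j + d' j)%N i = (before d i + before d' i)%N.
Proof. exact: big_split. Qed.

Lemma sum_before_after d i :
  (\sum_j d j = before d i + d i + \sum_(j < r | (i < j)%N) d j)%N.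
Proof.
rewrite (bigID (fun j : 'I_r => (j < i)%N)) /= -addnA; congr (_ + _)%N.
rewrite (bigD1 i) ?ltnn //=; congr (_ + _)%N; apply: eq_bigl => j.
by rewrite -leqNgt ltn_neqAle andbC eq_sym.
Qed.

(** The factor $f_i$ is crossed exactly by the $f'_j$ with $j < i$, so one unit of its degree
    accounts for [before d' i]. *)
Lemma crossing_decl i d d' : (0 < d i)%N ->
  crossing d d' = (crossing (dec i d) d' + before d' i)%N.
Proof.
move=> di; rewrite /crossing /before [X in (_ + X)%N]big_mkcond -big_split /=.
apply: eq_bigr => j _; rewrite (sum_dec _ di) mulnDr; congr (_ + _)%N.
by case: ltnP; rewrite ?muln1 ?muln0.
Qed.

Lemma crossing_decr i d d' : (0 < d' i)%N ->
  crossing d d' = (crossing d (dec i d') + \sum_(j < r | (i < j)%N) d j)%N.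
Proof.
move=> di; rewrite /crossing !(bigD1 i (P := predT)) //= /dec eqxx.
rewrite -{1}(prednK di) mulSn -addnA [LHS]addnC; congr (_ + _ + _)%N.
by apply: eq_bigr => j /negbTE ->.
Qed.

Lemma crossingDl d d' d'' :
  crossing (fun i => d i + d' i)%N d'' = (crossing d d'' + crossing d' d'')%N.
Proof.
rewrite /crossing -big_split; apply: eq_bigr => i _.
by rewrite big_split mulnDr.
Qed.

Lemma crossingDr d d' d'' :
  crossing d (fun i => d' i + d'' i)%N = (crossing d d' + crossing d d'')%N.
Proof.
by rewrite /crossing -big_split; apply: eq_bigr => i _; rewrite mulnDl.
Qed.

(** The three terms collect the pairs of slots above, below and on the diagonal. This is the parity
    behind graded commutativity. *)
Lemma crossing_total d d' :
  (crossing d d' + crossing d' d + \sum_i d i * d' i =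
   (\sum_i d i) * \sum_i d' i)%N.
Proof.
rewrite mulnC big_distrl /=.
have -> : crossing d' d = (\sum_i d' i * before d i)%N.
  transitivity (\sum_(i < r) \sum_(j < r | (i < j)%N) d i * d' j)%N.
    by apply: eq_bigr => i _; rewrite big_distrr.
  rewrite (exchange_big_dep predT) //=; apply: eq_bigr => i _.
  by rewrite /before big_distrr; apply: eq_bigr => j _; rewrite mulnC.
rewrite /crossing -!big_split; apply: eq_bigr => i _ /=.
rewrite (sum_before_after d i) [(d i * _)%N]mulnC -!mulnDr.
by congr (_ * _)%N; rewrite -addnA addnC.
Qed.

Lemma crossing0l d : crossing (fun=> 0%N) d = 0%N.
Proof. by rewrite /crossing big1 // => i _; rewrite big1 ?muln0. Qed.

Lemma crossing0r d : crossing d (fun=> 0%N) = 0%N.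
Proof. by rewrite /crossing big1. Qed.

(** Meant for the double sum in the square of the differential. The diagonal is a separate
    condition, since in characteristic 2 antisymmetry does not make it vanish. *)
Lemma sum_alternating (V : zmodType) (G : 'I_r -> 'I_r -> V) :
  (forall i, G i i = 0) -> (forall i j, (i < j)%N -> G i j = - G j i) ->
  \sum_i \sum_j G i j = 0.
Proof.
move=> Gii Gij.
transitivity (\sum_(i < r) (\sum_(j < r | (j < i)%N) G i j +
                      \sum_(j < r | (i < j)%N) G i j)).
  apply: eq_bigr => i _; rewrite (bigID (fun j : 'I_r => (j < i)%N)) /=.
  congr (_ + _); rewrite (bigD1 i) ?ltnn //= Gii add0r; apply: eq_bigl => j.
  by rewrite -leqNgt ltn_neqAle andbC eq_sym.
rewrite big_split /= [X in _ + X](exchange_big_dep predT) //= -big_split big1 //.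
move=> i _ /=; rewrite -big_split big1 // => j ji /=.
by rewrite (Gij _ _ ji) addrN.
Qed.
End Signs.

Lemma sign_scale (R : pzRingType) (V : lmodType R) (N N' : nat) (x : V) :
  odd N = odd N' -> (-1) ^+ N *: x = (-1) ^+ N' *: x.
Proof. by move=> NN; rewrite -signr_odd NN signr_odd. Qed.

Lemma sign_scale2 (R : pzRingType) (V : lmodType R) (p q p' q' : nat) (x : V) :
  odd (p + q) = odd (p' + q') ->
  (-1) ^+ p *: ((-1) ^+ q *: x) = (-1) ^+ p' *: ((-1) ^+ q' *: x).
Proof. by move=> pq; rewrite !scalerA -!exprD; apply: sign_scale. Qed.

(** A vanishing summand is exempt from the parity condition; this absorbs the slots of degree 0,
    where [dec] is truncated. *)
Lemma sign_scale_add (R : pzRingType) (V : lmodType R) (x y : V)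
    (p q t p1 q1 p2 q2 s2 : nat) :
  x = 0 \/ odd (p + q) = odd (p1 + q1) ->
  y = 0 \/ odd (p + q + t) = odd (p2 + q2 + s2) ->
  (-1) ^+ p *: ((-1) ^+ q *: (x + (-1) ^+ t *: y)) =
  (-1) ^+ p1 *: ((-1) ^+ q1 *: x) +
  (-1) ^+ p2 *: ((-1) ^+ q2 *: ((-1) ^+ s2 *: y)).
Proof.
move=> hx hy; rewrite !scalerDr !scalerA -!exprD; congr (_ + _).
  by case: hx => [->|pq]; [rewrite !scaler0 | exact: sign_scale].
by case: hy => [->|pq]; [rewrite !scaler0 | exact: sign_scale].
Qed.

(** * The DG algebra axioms for the Taylor operations *)

Section TaylorDG.
Variables (k : fieldType) (n r : nat) (B : 'I_r -> mbasis n).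
Local Notation R := {mpoly k[n]}.
Local Notation T := (taylor_basis B).
Local Notation fam := (forall i, free_mod k (B i)).
Local Notation e := (ebasis k).
Variable D : forall i, free_mod k (B i) -> free_mod k (B i).
Variable mul : forall i, free_mod k (B i) -> free_mod k (B i) -> free_mod k (B i).
Hypothesis dg : forall i, is_dg_algebra (@D i) (@mul i).
Implicit Types (f g h : fam) (a b c : T) (i j : 'I_r) (d : 'I_r -> nat).
Implicit Types (m : 'I_r -> 'X_{1..n}) (u v : free_mod k T).
Local Notation tD := (taylor_diff D).
Local Notation tmul := (taylor_mul mul).
Local Notation "f ** g" := (fun i => mul (f i) (g i)) (at level 40).

Let linD i : linear (@D i).
Proof. exact: cpx_linear (dg_complex (dg i)). Qed.
Let linl i y : linear (fun x => @mul i x y).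
Proof. exact: dg_linearl (dg i) y. Qed.
Let linr i x : linear (@mul i x).
Proof. exact: dg_linearr (dg i) x. Qed.
Let mdegD i w (x : free_mod k (B i)) : mhomog w x -> mhomog w (D x).
Proof. exact: cpx_mdeg (dg_complex (dg i)) _ _. Qed.
Let mdeg_mul i w w' (x y : free_mod k (B i)) :
  mhomog w x -> mhomog w' y -> mhomog (w + w')%MM (mul x y).
Proof. exact: dg_mdeg (dg i) _ _ _ _. Qed.
Let tDP := taylor_diff_tens linD mdegD.
Let tmulP := taylor_mul_tens linl linr mdeg_mul.
Let lintD := taylor_diff_linear D.
Let lintl := taylor_mul_linearl mul.
Let lintr := taylor_mul_linearr mul.

Let dg_mul0l i x : @mul i 0 x = 0.
Proof.
by rewrite (linear_coord _ (linl x)) big1 // => y _; rewrite ffunE scale0r.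
Qed.

Let dg_mul0r i x : @mul i x 0 = 0.
Proof.
by rewrite (linear_coord _ (linr x)) big1 // => y _; rewrite ffunE scale0r.
Qed.

Lemma hhomog_slot d f i j : (forall i, hhomog (d i) (f i)) ->
  hhomog (dec i d j) (slot D i f j).
Proof.
move=> hf; rewrite /dec /slot; case: eqP => // _.
case dj: (d j) => [|dj'] /=; last first.
  by apply: cpx_hdegS (dg_complex (dg j)) _ _ _; rewrite -dj.
rewrite (cpx_hdeg0 (dg_complex (dg j))) -?dj //; exact: hhomog0.
Qed.

Lemma slot_deg0 d f i : (forall i, hhomog (d i) (f i)) -> d i = 0%N ->
  slot D i f i = 0.
Proof.
move=> hf di; rewrite /slot eqxx (cpx_hdeg0 (dg_complex (dg i))) //.
by rewrite -di.
Qed.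

Lemma mhomog_tD w u : mhomog w u -> mhomog w (tD u).
Proof.
move=> hu; rewrite -[w]add0m; apply: linear_mhomog hu => // a.
by rewrite add0m taylor_diff_ebasis; apply: mhomog_taylor_diff_star.
Qed.

Lemma mhomog_tmul w w' u v : mhomog w u -> mhomog w' v ->
  mhomog (w + w')%MM (tmul u v).
Proof.
move=> hu hv; rewrite addmC; apply: (linear_mhomog (lintl v)) hu => a.
rewrite addmC; apply: (linear_mhomog (lintr _)) hv => b.
by rewrite taylor_mul_ebasis; apply: mhomog_taylor_mul_star.
Qed.

Lemma tD_sq0 d f : (forall i, hhomog (d i) (f i)) ->
  ev (tD (\sum_i ((-1) ^+ before d i : R) *: tens (slot D i f))) = 0.
Proof.
move=> hf; have -> : ev (tD (\sum_i ((-1) ^+ before d i : R) *: tens (slot D i f))) =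
    ev (\sum_i \sum_j ((-1) ^+ before d i : R) *:
      (((-1) ^+ before (dec i d) j : R) *: tens (slot D j (slot D i f)))).
  under [in RHS]eq_bigr => i _ do rewrite -scaler_sumr.
  apply: (ev_linear_sumZ lintD erefl) => i; apply: tDP => // j.
  exact: hhomog_slot.
rewrite sum_alternating ?ev0 // => [i|i j ij].
  rewrite (@tens_eq0 _ _ _ _ _ i) ?scaler0 //.
  by rewrite /slot eqxx (cpx_sq0 (dg_complex (dg i))).
have nij : (i == j) = false by apply: contraTF ij => /eqP ->; rewrite ltnn.
rewrite (tens_ext (g := slot D i (slot D j f))); last first.
  move=> l; rewrite /slot; case: (l =P i) => [->|_]; last by case: (l == j).
  by rewrite nij.
case: (posnP (d i)) => [di|di].
  rewrite (@tens_eq0 _ _ _ _ (slot D i _) i) ?scaler0 ?oppr0 //.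
  rewrite {1}/slot eqxx {1}/slot nij.
  by have := slot_deg0 hf di; rewrite /slot eqxx.
(* For $i < j$, a differential in slot [i] lowers [before _ j] by one, while one in slot [j] leaves
   [before _ i] unchanged. This single unit is the sign. *)
rewrite !scalerA -!exprD -[RHS]scaleN1r scalerA -exprS; apply: sign_scale.
rewrite (before_dec_lt di ij) (before_dec_ge d (ltnW ij)).
by rewrite /= !oddD /=; case: odd; case: odd.
Qed.

Lemma tens_leibniz d d' f g i :
  (forall i, hhomog (d i) (f i)) -> (forall i, hhomog (d' i) (g i)) ->
  tens (slot D i (f ** g)) = tens (slot D i f ** g) +
    ((-1) ^+ d i : R) *: tens (f ** slot D i g).
Proof.
move=> hf hg.
pose h j := if j == i then ((-1) ^+ d j : R) *: mul (f j) (D (g j))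
  else mul (f j) (g j).
rewrite (@tens_add _ _ _ _ i _ (slot D i f ** g) h); first last.
- by move=> j ji; rewrite /slot /h (negbTE ji).
- by move=> j ji; rewrite /slot (negbTE ji).
- by rewrite /slot /h eqxx; apply: (dg_leibniz (dg i) (hf i) (hg i)).
congr (_ + _); apply: (tens_scale1 (i := i)); first by rewrite /h /slot eqxx.
by move=> j ji; rewrite /h /slot (negbTE ji).
Qed.

(** In the first term, [before d' i] is exactly the crossing lost by lowering [d i]. In the second,
    [before d i], [d i] and the degrees after slot [i] add up to the total degree of [f], which is
    the Leibniz sign. *)
Lemma leibniz_signs d d' f g i :
  (forall i, hhomog (d i) (f i)) -> (forall i, hhomog (d' i) (g i)) ->
  ((-1) ^+ crossing d d' : R) *:
    (((-1) ^+ before (fun j => d j + d' j)%N i : R) *: tens (slot D i (f ** g))) =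
  ((-1) ^+ before d i : R) *:
    (((-1) ^+ crossing (dec i d) d' : R) *: tens (slot D i f ** g)) +
  ((-1) ^+ (\sum_i d i)%N : R) *: (((-1) ^+ before d' i : R) *:
    (((-1) ^+ crossing d (dec i d') : R) *: tens (f ** slot D i g))).
Proof.
move=> hf hg; rewrite (tens_leibniz i hf hg); apply: sign_scale_add.
  case: (posnP (d i)) => di; [left|right].
    by apply: (tens_eq0 (i := i)); rewrite (slot_deg0 hf di) dg_mul0l.
  by rewrite (crossing_decl _ di) beforeD !oddD; do 3!case: odd.
case: (posnP (d' i)) => di; [left|right].
  by apply: (tens_eq0 (i := i)); rewrite (slot_deg0 hg di) dg_mul0r.
rewrite (crossing_decr _ di) beforeD (sum_before_after d i) !oddD.
by do 5!case: odd.
Qed.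

Lemma taylor_dg_algebra : is_dg_algebra tD tmul.
Proof.
have hhe a i : hhomog (homdeg (a i)) (e (a i)) by apply: hhomog_ebasis.
have tDe a : ev (tD (e a)) = ev (\sum_i ((-1) ^+ before (fun i => homdeg (a i)) i
    : R) *: tens (slot D i (fun i => e (a i)))).
  by apply: tDP => //; rewrite tens_ebasis.
have tmule a b : ev (tmul (e a) (e b)) = ev (((-1) ^+ crossing
    (fun i => homdeg (a i)) (fun i => homdeg (b i)) : R)
    *: tens (fun i => mul (e (a i)) (e (b i)))).
  by apply: tmulP => //; rewrite tens_ebasis.
(* The unit is $1 * \cdots * 1$, formed with [star] at trivial multidegrees, whose lcm is again
   trivial. *)
have [one one_unit] := fin_all_exists (fun i => dg_unit (dg i)).
have one_bi i : bigraded 0 0%MM (one i) by case: (one_unit i).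
have ev1 : ev (star (fun=> 0%MM) one) = ev (tens one).
  by apply: ev_star => i; case: (one_bi i).
have lcm0 : lcm_mon (fun _ : 'I_r => 0%MM) = 0%MM :> 'X_{1..n}.
  by apply: (big_ind (fun w => w = 0%MM)) => // x y -> ->; rewrite mlc0m.
have m1 : mhomog 0%MM (star (fun=> 0%MM) one)
    by have := @mhomog_star k n r B (fun=> 0%MM) one; rewrite lcm0.
have hmul i p q (x y : free_mod k (B i)) :
  hhomog p x -> hhomog q y -> hhomog (p + q) (mul x y).
  exact: (@dg_hdeg _ _ _ _ _ (dg i) p q x y).
apply: (@dg_algebra_of_basis _ _ T tD tmul (star (fun=> 0%MM) one)).
- exact: lintD.
- exact: lintl.
- exact: lintr.
- move=> a p ap; apply: hhomog_ev (tDe a); first exact/mhomog_tD/mhomog_ebasis.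
  apply: hhomog_sum => i _; apply: hhomogZ.
  case: (posnP (homdeg (a i))) => ai.
    rewrite (@tens_eq0 _ _ _ _ _ i) ?(slot_deg0 (hhe a) ai) //; exact: hhomog0.
  have := hhomog_tens (fun j => @hhomog_slot _ _ i j (hhe a)).
  rewrite (_ : (\sum_j _)%N = p) //; apply/eqP; rewrite -eqSS -ap.
  by rewrite /= (sum_dec predT ai) addn1.
- move=> a a0; apply: (ev_inj (m := multideg a)).
  + exact/mhomog_tD/mhomog_ebasis.
  + exact: mhomog0.
  rewrite tDe big1 // => i _; rewrite (@tens_eq0 _ _ _ _ _ i) ?scaler0 //.
  apply: slot_deg0 (hhe a) _; apply/eqP; rewrite -leqn0 -a0 /=.
  by rewrite (bigD1 i) //= leq_addr.
- by move=> a; apply/mhomog_tD/mhomog_ebasis.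
- move=> a; apply: (ev_inj (m := multideg a)).
  + exact/mhomog_tD/mhomog_tD/mhomog_ebasis.
  + exact: mhomog0.
  by rewrite (linear_ev lintD (tDe a)) tD_sq0 // ev0.
- split; last exact: m1.
  apply: (hhomog_ev m1 _ ev1).
  have h : hhomog (\sum_(i < r) 0)%N (tens one).
    by apply: hhomog_tens => i; case: (one_bi i).
  by rewrite big1_eq in h.
- move=> a; apply: (ev_inj (m := multideg a)).
  + by rewrite -[multideg a]add0m; apply: mhomog_tmul => //; apply: mhomog_ebasis.
  + exact: mhomog_ebasis.
  rewrite (@tmulP (fun=> 0%N) one (fun i => homdeg (a i)) (fun i => e (a i))) //.
  + rewrite crossing0l scale1r -[e a in RHS]tens_ebasis; congr ev.
    by apply: tens_ext => i; case: (one_unit i) => _ /(_ (e (a i))) [].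
  + by move=> i; case: (one_bi i).
  + by rewrite tens_ebasis.
- move=> a; apply: (ev_inj (m := multideg a)).
  + by rewrite -[multideg a]addm0; apply: mhomog_tmul => //; apply: mhomog_ebasis.
  + exact: mhomog_ebasis.
  rewrite (@tmulP (fun i => homdeg (a i)) (fun i => e (a i)) (fun=> 0%N) one) //.
  + rewrite crossing0r scale1r -[e a in RHS]tens_ebasis; congr ev.
    by apply: tens_ext => i; case: (one_unit i) => _ /(_ (e (a i))) [].
  + by move=> i; case: (one_bi i).
  + by rewrite tens_ebasis.
- move=> a b c; apply: (ev_inj (m := (multideg a + multideg b + multideg c)%MM)).
  + rewrite -addmA; do 2?[apply: mhomog_tmul]; exact: mhomog_ebasis.
  + by do 2?[apply: mhomog_tmul]; apply: mhomog_ebasis.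
  have -> : ev (tmul (e a) (tmul (e b) (e c))) =
      ev (((-1) ^+ crossing (fun i => homdeg (b i)) (fun i => homdeg (c i)) : R) *:
        (((-1) ^+ crossing (fun i => homdeg (a i))
          (fun i => homdeg (b i) + homdeg (c i))%N : R) *:
        tens (fun i => mul (e (a i)) (mul (e (b i)) (e (c i)))))).
    apply: (ev_linearZ (lintr (e a)) (tmule b c)).
    by apply: tmulP => //; [move=> i; apply: hmul | rewrite tens_ebasis].
  have -> : ev (tmul (tmul (e a) (e b)) (e c)) =
      ev (((-1) ^+ crossing (fun i => homdeg (a i)) (fun i => homdeg (b i)) : R) *:
        (((-1) ^+ crossing (fun i => homdeg (a i) + homdeg (b i))%N
          (fun i => homdeg (c i)) : R) *:
        tens (fun i => mul (mul (e (a i)) (e (b i))) (e (c i))))).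
    apply: (ev_linearZ (lintl (e c)) (tmule a b)).
    by apply: tmulP => //; [move=> i; apply: hmul | rewrite tens_ebasis].
  have assoc i := dg_assoc (dg i) (e (a i)) (e (b i)) (e (c i)).
  rewrite (tens_ext assoc); apply: (congr1 (@ev k n T)); apply: sign_scale2.
  (* [crossing] is biadditive, so both bracketings give the sum of the crossings of the three pairs
     (a,b), (a,c) and (b,c). *)
  by rewrite crossingDl crossingDr !oddD; do 3!case: odd.
- move=> a b; apply: hhomog_ev (tmule a b).
    by apply: mhomog_tmul; apply: mhomog_ebasis.
  apply: hhomogZ; rewrite /= -big_split; apply: hhomog_tens => i.
  exact: hmul.
- by move=> a b; apply: mhomog_tmul; apply: mhomog_ebasis.
- move=> a b; have ha := @mhomog_ebasis k n T a.
  have hb := @mhomog_ebasis k n T b.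
  apply: (ev_inj (m := (multideg a + multideg b)%MM)).
  + exact/mhomog_tD/mhomog_tmul.
  + apply: mhomogD; last apply: mhomog_sign.
      exact/mhomog_tmul/hb/mhomog_tD.
    exact/mhomog_tmul/mhomog_tD.
  have E1 : ev (tD (tmul (e a) (e b))) =
      ev (\sum_i ((-1) ^+ crossing (fun i => homdeg (a i)) (fun i => homdeg (b i))
        : R) *: (((-1) ^+ before (fun j => homdeg (a j) + homdeg (b j))%N i : R) *:
        tens (slot D i (fun i => mul (e (a i)) (e (b i)))))).
    rewrite -scaler_sumr; apply: (ev_linearZ lintD (tmule a b)).
    by apply: tDP => // i; apply: hmul.
  have E2 : ev (tmul (tD (e a)) (e b)) =
      ev (\sum_i ((-1) ^+ before (fun j => homdeg (a j)) i : R) *: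
        (((-1) ^+ crossing (dec i (fun j => homdeg (a j)))
          (fun j => homdeg (b j)) : R) *:
        tens (slot D i (fun i => e (a i)) ** (fun i => e (b i))))).
    apply: (ev_linear_sumZ (lintl (e b)) (tDe a)) => i.
    apply: tmulP => //; last by rewrite tens_ebasis.
    by move=> j; apply: hhomog_slot.
  have E3 : ev (tmul (e a) (tD (e b))) =
      ev (\sum_i ((-1) ^+ before (fun j => homdeg (b j)) i : R) *:
        (((-1) ^+ crossing (fun j => homdeg (a j))
          (dec i (fun j => homdeg (b j))) : R) *:
        tens ((fun i => e (a i)) ** slot D i (fun i => e (b i))))).
    apply: (ev_linear_sumZ (lintr (e a)) (tDe b)) => i.
    apply: tmulP => //; last by rewrite tens_ebasis.
    by move=> j; apply: hhomog_slot.
  rewrite evD evZ E1 E2 E3 -evZ -evD scaler_sumr -big_split.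
  apply: (congr1 (@ev k n T)).
  by apply: eq_bigr => i _; apply: leibniz_signs.
- move=> a b; have ha := @mhomog_ebasis k n T a.
  have hb := @mhomog_ebasis k n T b.
  apply: (ev_inj (m := (multideg a + multideg b)%MM)).
  + exact: mhomog_tmul.
  + by apply: mhomog_sign; rewrite addmC; apply: mhomog_tmul.
  rewrite tmule [RHS]evZ tmule -[RHS]evZ.
  apply: (congr1 (@ev k n T)).
  rewrite (tens_ext (fun i => dg_comm (dg i) (hhe a i) (hhe b i))) tens_scale.
  rewrite prodrXr; apply: sign_scale2.
  by rewrite /= -crossing_total !oddD; do 3!case: odd.
- move=> a odd_a; apply: (ev_inj (m := (multideg a + multideg a)%MM)).
  + by apply: mhomog_tmul; apply: mhomog_ebasis.
  + exact: mhomog0.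
  (* An odd total degree has an odd summand, and the square of that factor is 0. Commutativity alone
     would only give that twice the square vanishes. *)
  rewrite tmule; case: (pickP (fun i => odd (homdeg (a i)))) => [i ai|even_a].
    by rewrite (tens_eq0 (i := i)) ?scaler0 // (dg_sq0 (dg i) (hhe a i)).
  suff : odd (\sum_i homdeg (a i)) = false
    by rewrite -[X in odd X]/(homdeg a) odd_a.
  by apply: (big_ind (fun x => odd x = false)) => // x y hx hy; rewrite oddD hx hy.
Qed.

(** [star] is not R-multilinear, so the formula does not follow from the bilinear extension by
    expanding the factors. Instead both sides have multidegree [lcm_mon m + lcm_mon m'] and the same
    value at one. *)
Lemma taylor_mul_starE d d' m m' f g :
  (forall i, bigraded (d i) (m i) (f i)) ->
  (forall i, bigraded (d' i) (m' i) (g i)) ->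
  tmul (star m f) (star m' g) = taylor_mul_star mul d m f d' m' g.
Proof.
move=> hf hg; have hdf i := proj1 (hf i); have hmf i := proj2 (hf i).
have hdg i := proj1 (hg i); have hmg i := proj2 (hg i).
apply: (ev_inj (m := (lcm_mon m + lcm_mon m')%MM)).
- by apply: mhomog_tmul; apply: mhomog_star.
- exact: mhomog_taylor_mul_star.
apply: etrans (esym (ev_taylor_mul_star mdeg_mul d d' hmf hmg)).
by apply: (tmulP hdf hdg); apply: ev_star.
Qed.
End TaylorDG.


Theorem theorem2p2 (k : fieldType) (n r : nat)
  (I : 'I_r -> {mpoly k[n]} -> Prop)
  (B : 'I_r -> mbasis n)
  (D : forall i : 'I_r, free_mod k (B i) -> free_mod k (B i))
  (mul : forall i : 'I_r, free_mod k (B i) -> free_mod k (B i) -> free_mod k (B i))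
  (hI : forall i : 'I_r, monomial_ideal (I i))
  (hres : forall i : 'I_r, is_resolution (D i) (I i))
  (hdg : forall i : 'I_r, is_dg_algebra (D i) (mul i)) :
  is_dg_algebra (taylor_diff D) (taylor_mul mul) /\
  (forall (d d' : 'I_r -> nat) (m m' : 'I_r -> 'X_{1..n})
     (f f' : forall i : 'I_r, free_mod k (B i)),
     (forall i : 'I_r, bigraded (d i) (m i) (f i)) ->
     (forall i : 'I_r, bigraded (d' i) (m' i) (f' i)) ->
     taylor_mul mul (star m f) (star m' f') =
       taylor_mul_star mul d m f d' m' f').

Proof.
split; first exact: taylor_dg_algebra.
by move=> d d' m m' f f'; apply: taylor_mul_starE.
Qed.
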